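(* For an arbitrary point $w\in\Omega$, the vector $\psi(w)$ (defined, as in the context, by positive coefficients $\sigma_F,\dots,\sigma_{-F}$ subject to the two constraints and the $2F-1$ product conditions) is given by $$\psi(w)_l=\sqrt{\frac{r^l}{\sum_{k=-F}^F\|w_k\|_2^2\,r^k}}\;w_l,\qquad l=F,\dots,-F,$$ where $r$ is the unique positive zero of the polynomial $$h_2(t)=\sum_{l=0}^{2F}(l-F-M)\,\|w_{l-F}\|_2^2\,t^l.$$
   Context: Let $F\ge 1$ be an integer, $n$ a positive even integer, $N=2n(2F+1)$, and let $M$ be a real number with $0\le M<F$ and $M\notin\mathbb{Z}$. Vectors $w\in\mathbb{R}^N$ are written in blocks $w=(w_F;w_{F-1};\dots;w_{-F})$ with $w_l\in\mathbb{R}^{2n}$, the index $l$ ranging over the integers from $-F$ to $F$. Let $$\Omega=\Big\{w\in\mathbb{R}^N : \sum_{l<M}\|w_l\|_2^2>0,\ \sum_{l>M}\|w_l\|_2^2>0\Big\}.$$ For $w\in\Omega$, $\psi(w)\in\mathbb{R}^N$ is defined by $\psi(w)_l=\sigma_l w_l$, $l=F,\dots,-F$, where $\sigma_F,\dots,\sigma_{-F}$ are positive real coefficients (depending on $w$) satisfying the constraints $$\sum_{l=-F}^F\|w_l\|_2^2\sigma_l^2=1,\qquad \sum_{l=-F}^F l\,\|w_l\|_2^2\sigma_l^2=M,$$ together with $$\sigma_{l-1}\sigma_{l+1}=\sigma_l^2\quad(l=1,\dots,F-1),\qquad \sigma_l\sigma_{-l}=\sigma_0^2\quad(l=1,\dots,F).$$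 *)

(* Defs.v *)
From HB Require Import structures.
From mathcomp Require Import all_boot all_order all_algebra.
From mathcomp Require Import boolp classical_sets reals.
Set Implicit Arguments.
Unset Strict Implicit.
Unset Printing Implicit Defensive.
Import Order.TTheory GRing.Theory Num.Theory.
Local Open Scope ring_scope.

(* The integers F, F - 1, ..., - F, in this order. *)
Definition levels (F : nat) : seq int :=
  [seq F%:Z - i%:Z | i <- iota 0 (2 * F).+1].

(* The dimension N is kept as a sum so that the library's block columns
   (\mxcol, submxcol) apply directly; see dimNE. *)
Definition dimN (F n : nat) : nat := (\sum_(i < (2 * F).+1) 2 * n)%N.

Lemma dimNE (F n : nat) : dimN F n = (2 * n * (2 * F + 1))%N.
Proof. by rewrite /dimN sum_nat_const card_ord mulnC addn1. Qed.

Section Blocks.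
Variables (R : realType) (F n : nat).
Implicit Types (M : R) (w v : 'cV[R]_(dimN F n)) (sigma : int -> R).

(* The first block has level F and the last one level - F, so the block of
   level l is at position F - l; meaningful only for l \in levels F. *)
Definition block w (l : int) : 'cV[R]_(2 * n) :=
  @submxcol R _ (fun=> (2 * n)%N) 1 w (inord (absz (F%:Z - l)%R)).

Definition blockvec (f : int -> 'cV[R]_(2 * n)) : 'cV[R]_(dimN F n) :=
  \mxcol_(i < (2 * F).+1) f (F%:Z - i%:Z).

(* The norm provided by the library on matrices is the sup norm. *)
Definition norm2 (m : nat) (u : 'cV[R]_m) : R :=
  Num.sqrt (\sum_j u j 0 ^+ 2).

Definition Omega M : set 'cV[R]_(dimN F n) :=
  [set w | 0 < \sum_(l <- levels F | l%:~R < M) norm2 (block w l) ^+ 2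
        /\ 0 < \sum_(l <- levels F | M < l%:~R) norm2 (block w l) ^+ 2].

(* Only the values of sigma on levels F matter. *)
Definition psi_coeffs M w sigma : Prop :=
  [/\ forall l : int, l \in levels F -> 0 < sigma l,
      \sum_(l <- levels F) norm2 (block w l) ^+ 2 * sigma l ^+ 2 = 1,
      \sum_(l <- levels F)
         l%:~R * norm2 (block w l) ^+ 2 * sigma l ^+ 2 = M,
      forall l : int, 1 <= l <= F%:Z - 1 ->
        sigma (l - 1) * sigma (l + 1) = sigma l ^+ 2
    & forall l : int, 1 <= l <= F%:Z -> sigma l * sigma (- l) = sigma 0 ^+ 2].

(* v is a value of psi at w. That such a v exists and is unique for
   w in Omega is not built into the definition. *)
Definition is_psi M w v : Prop :=
  exists sigma : int -> R,
    psi_coeffs M w sigma /\ v = blockvec (fun l => sigma l *: block w l).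

Definition h2 M w : {poly R} :=
  \poly_(l < (2 * F).+1)
    ((l%:R - F%:R - M) * norm2 (block w (l%:Z - F%:Z)) ^+ 2).

End Blocks.

(* Main.v *)
Require Import Defs.
From HB Require Import structures.
From mathcomp Require Import all_boot all_order all_algebra.
From mathcomp Require Import ring zify.
From mathcomp Require Import boolp classical_sets reals.
Set Implicit Arguments.
Unset Strict Implicit.
Unset Printing Implicit Defensive.
Import Order.TTheory GRing.Theory Num.Theory.
Local Open Scope ring_scope.

(** Write a_l for the squared norm of the block w_l, and call
      S(t) = sum_l a_l t^l,   H(t) = sum_l (l - M) a_l t^l
    the partition sum and the centered moment. Then h2(t) = t^F H(t), so the
    positive zeros of h2 are those of H.

    Let m be the integer part of M. As M is not an integer, l - M and l - m
    agree in sign, except that l - m vanishes for l = m. In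
      t^(-m) H(t) = sum_l (l - M) a_l t^(l - m)
    every summand is therefore nondecreasing in t > 0: a positive coefficient
    goes with an increasing power and a negative one with a nonincreasing power.
    The sum increases strictly because w lies in Omega, so H has at most one
    positive zero (centered_moment_zero_inj). The same signs compare
    t^(-m) H(t) with the affine function P t - N, where P and N are the total
    absolute coefficients above and below M; the latter bounds the former from
    above on ]0, 1] and from below on [1, +oo[. Both P and N are positive on
    Omega, so H changes sign (centered_moment_sign_change), and the intermediate
    value theorem applied to h2 gives the zero r.

    The product conditions say that log sigma_l is affine in l for l >= 0, and
    that it continues to the negative levels by the same affine law; hence
    sigma_l = c q^l (product_conditions_geometric). With t = q^2 the two
    constraints become c^2 S(t) = 1 and c^2 (H(t) + M S(t)) = M, that is,
    c^2 = 1 / S(t) and H(t) = 0. So t = r and sigma_l = sqrt (r^l / S(r))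
    (psi_coeffs_sqrt), and reading this backwards shows that these values do
    satisfy all the conditions (psi_coeffs_of_zero). *)

(** * The positive zero of a centered moment *)

Section PositiveZero.
Variables (R : rcfType) (s : seq int) (a : int -> R) (M : R) (m : int).
Hypothesis a_ge0 : forall l, 0 <= a l.
Hypothesis ltmM : m%:~R < M.
Hypothesis ltMm1 : M < (m + 1)%:~R.

Lemma weighted_sum_gt0 (P : pred int) (c : int -> R) :
    (forall l, P l -> 0 < c l) ->
  0 < \sum_(l <- s | P l) a l -> 0 < \sum_(l <- s | P l) c l * a l.
Proof.
move=> c_gt0 sa_gt0.
have ca_ge0 l : P l -> 0 <= c l * a l by move=> /c_gt0/ltW/mulr_ge0; apply.
rewrite lt_neqAle sumr_ge0 // andbT eq_sym; apply/negP.
rewrite psumr_eq0 // => /allP ca0.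
suff sa0 : \sum_(l <- s | P l) a l = 0 by rewrite sa0 ltxx in sa_gt0.
apply: big1_seq => l /andP[Pl /ca0]; rewrite Pl mulf_eq0.
by rewrite (gt_eqF (c_gt0 _ Pl)) => /eqP.
Qed.

Definition centered_moment (t : R) : R :=
  \sum_(l <- s) (l%:~R - M) * a l * t ^ l.

(** Multiplying the centered moment by t^(- m) makes each summand
    nondecreasing in t. *)
Definition tilted (t : R) : R := \sum_(l <- s) (l%:~R - M) * a l * t ^ (l - m).

Lemma centered_momentE t : 0 < t -> centered_moment t = t ^ m * tilted t.
Proof.
move=> t_gt0; rewrite mulr_sumr; apply: eq_bigr => l _.
have -> : t ^ l = t ^ (l - m) * t ^ m by rewrite -expfzDr ?subrK ?lt0r_neq0.
by ring.
Qed.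

Lemma level_gtM l : (M < l%:~R) = (m + 1 <= l).
Proof.
apply/idP/idP => [lM | ml].
  by rewrite -ltzD1 ltrD2r -(ltr_int R) (lt_trans ltmM).
by apply: lt_le_trans ltMm1 _; rewrite ler_int.
Qed.

Lemma level_ltM l : (l%:~R < M) = ~~ (M < l%:~R).
Proof.
rewrite level_gtM -ltNge ltzD1; apply/idP/idP => [lM | lm].
  by rewrite -ltzD1 -(ltr_int R) (lt_trans lM).
by apply: le_lt_trans ltmM; rewrite ler_int.
Qed.

Let P := \sum_(l <- s | M < l%:~R) (l%:~R - M) * a l.
Let N := \sum_(l <- s | l%:~R < M) (M - l%:~R) * a l.

(** The affine function P y - N arises by replacing t^(l - m) with y above M
    and with 1 below M. *)
Lemma split_sign (y : R) :
  \sum_(l <- s) (l%:~R - M) * a l * (if M < l%:~R then y else 1) = P * y - N.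
Proof.
rewrite (bigID (fun l : int => M < l%:~R)) /=; congr (_ + _).
  by rewrite mulr_suml; apply: eq_bigr => l ->.
rewrite -sumrN; apply: eq_big => [l | l /negbTE ->].
  by rewrite -level_ltM.
by rewrite mulr1 -mulNr opprB.
Qed.

(** For 1 <= t, the power t^(l - m) is at least t above M, where l - m >= 1,
    and at most 1 below M, where the coefficient is negative. *)
Lemma tilted_ge t : 1 <= t -> P * t - N <= tilted t.
Proof.
move=> t1; rewrite -split_sign; apply: ler_sum => l _.
case: ifPn => [lM | lM].
  apply: ler_wpM2l; first by rewrite mulr_ge0 // subr_ge0 ltW.
  rewrite -[leLHS]expr1z; apply: ler_weXz2l => //.
  by move: lM; rewrite level_gtM; lia.
apply: ler_wnM2l.
  by rewrite mulr_le0_ge0 // subr_le0 ltW // level_ltM.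
rewrite -(expr0z t); apply: ler_weXz2l => //.
by move: lM; rewrite level_gtM; lia.
Qed.

(** For t <= 1 both comparisons of powers are reversed. *)
Lemma tilted_le t : 0 < t -> t <= 1 -> tilted t <= P * t - N.
Proof.
move=> t_gt0 t1; rewrite -split_sign; apply: ler_sum => l _.
have ti1 : 1 <= t^-1 by rewrite invf_ge1.
(* The monotonicity of powers in the exponent is used at the base t^-1 >= 1. *)
have tE k : t ^ k = t^-1 ^ (- k) by rewrite exprz_inv opprK.
case: ifPn => [lM | lM].
  apply: ler_wpM2l; first by rewrite mulr_ge0 // subr_ge0 ltW.
  rewrite -[leRHS]expr1z !tE; apply: ler_weXz2l => //.
  by move: lM; rewrite level_gtM; lia.
apply: ler_wnM2l.
  by rewrite mulr_le0_ge0 // subr_le0 ltW // level_ltM.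
rewrite -(expr0z t) !tE; apply: ler_weXz2l => //.
by move: lM; rewrite level_gtM; lia.
Qed.

Hypothesis upper_gt0 : 0 < \sum_(l <- s | M < l%:~R) a l.

(** Each summand is nondecreasing, and those above M with a nonzero weight
    increase strictly. *)
Lemma tilted_incr x y : 0 < x -> x < y -> tilted x < tilted y.
Proof.
move=> x_gt0 ltxy; have y_gt0 := lt_trans x_gt0 ltxy.
rewrite -subr_gt0 -sumrB.
under eq_bigr => l _ do rewrite -mulrBr mulrAC.
(* The part above M of the difference is a positively weighted sum. *)
rewrite (bigID (fun l : int => M < l%:~R)) /=; apply: ltr_pwDl.
  apply: weighted_sum_gt0 => // l lM; rewrite mulr_gt0 ?subr_gt0 //.
  rewrite ltr_pXz2r ?nnegrE ?ltW //.
  by move: lM; rewrite level_gtM; lia.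
apply: sumr_ge0 => l lM; apply: mulr_ge0 => //; apply: mulr_le0.
  by rewrite subr_le0 ltW // level_ltM.
rewrite subr_le0; apply: ler_wnXz2r; rewrite ?posrE ?(ltW ltxy) //.
by move: lM; rewrite level_gtM; lia.
Qed.

Lemma centered_moment_zero_inj x y :
  0 < x -> 0 < y -> centered_moment x = 0 -> centered_moment y = 0 -> x = y.
Proof.
move=> x_gt0 y_gt0; rewrite !centered_momentE // => /eqP + /eqP.
rewrite !mulf_eq0 !(gt_eqF (exprz_gt0 _ _)) //= => /eqP x0 /eqP y0.
by case: (ltgtP x y) => // [/(tilted_incr x_gt0)|/(tilted_incr y_gt0)];
  rewrite x0 y0 ltxx.
Qed.

Hypothesis lower_gt0 : 0 < \sum_(l <- s | l%:~R < M) a l.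

Lemma centered_moment_sign_change :
  exists x y : R, [/\ 0 < x, x <= y, centered_moment x <= 0
    & 0 <= centered_moment y].
Proof.
have P_gt0 : 0 < P by apply: weighted_sum_gt0 => // l; rewrite subr_gt0.
have N_gt0 : 0 < N by apply: weighted_sum_gt0 => // l; rewrite subr_gt0.
have PN_gt0 := addr_gt0 P_gt0 N_gt0.
have x_gt0 : 0 < N / (P + N) by rewrite divr_gt0.
have x_le1 : N / (P + N) <= 1 by rewrite ler_pdivrMr // mul1r lerDr ltW.
have y_ge1 : 1 <= (P + N) / P by rewrite ler_pdivlMr // mul1r lerDl ltW.
(* P x - N = - N^2 / (P + N) and P y - N = P; also x <= 1 <= y, so the affine
   bounds apply at both points. *)
exists (N / (P + N)), ((P + N) / P); split=> //.
- exact: le_trans x_le1 y_ge1.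
- rewrite centered_momentE // pmulr_rle0 ?exprz_gt0 //.
  apply: le_trans (tilted_le x_gt0 x_le1) _.
  by rewrite subr_le0 mulrA ler_pdivrMr // mulrC ler_pM2l // lerDl ltW.
have y_gt0 := lt_le_trans ltr01 y_ge1.
rewrite centered_momentE // pmulr_rge0 ?exprz_gt0 //.
apply: le_trans (tilted_ge y_ge1).
by rewrite mulrC divfK ?lt0r_neq0 // addrK ltW.
Qed.

End PositiveZero.

(** * Levels, blocks and the polynomial h2 *)

Section PsiCoefficients.
Variables (R : realType) (F n : nat) (M : R) (w : 'cV[R]_(dimN F n)).

Let a l := norm2 (block w l) ^+ 2.

Lemma mem_levels l : (l \in levels F) = (- F%:Z <= l <= F%:Z).
Proof.
apply/mapP/idP => [[i] | lF]; first by rewrite mem_iota => iF ->; lia.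
by exists (absz (F%:Z - l)); [rewrite mem_iota; lia | lia].
Qed.

(** The list of levels descends from F, while the monomials of h2 run through
    the levels upwards from - F. *)
Lemma big_levels (f : int -> R) :
  \sum_(l <- levels F) f l = \sum_(i < (2 * F).+1) f (i%:Z - F%:Z).
Proof.
rewrite big_map -[iota _ _]/(index_iota 0 (2 * F).+1) big_mkord.
rewrite (reindex_inj rev_ord_inj); apply: eq_bigr => i _ /=.
by congr f; have := ltn_ord i; lia.
Qed.

Lemma eq_blockvec (f g : int -> 'cV[R]_(2 * n)) :
  {in levels F, f =1 g} -> blockvec F f = blockvec F g.
Proof.
move=> fg; apply: eq_mxcol => i; apply: fg.
by rewrite mem_levels; have := ltn_ord i; lia.
Qed.

Lemma horner_h2 t : 0 < t ->
  (h2 M w).[t] = t ^ F%:Z * centered_moment (levels F) a M t.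
Proof.
move=> t_gt0; rewrite horner_poly /centered_moment big_levels mulr_sumr.
apply: eq_bigr => i _.
have -> : t ^+ i = t ^ F%:Z * t ^ (i%:Z - F%:Z).
  by rewrite -expfzDr ?lt0r_neq0 // addrC subrK.
by rewrite rmorphB /= /a; ring.
Qed.

Lemma root_h2 t : 0 < t ->
  root (h2 M w) t = (centered_moment (levels F) a M t == 0).
Proof.
by move=> t_gt0; rewrite rootE horner_h2 // mulf_eq0 (gt_eqF (exprz_gt0 _ _)).
Qed.

(** * The coefficients of psi as a geometric sequence *)

(** The conditions sigma_(l-1) sigma_(l+1) = sigma_l^2 fix the ratio of
    consecutive terms on the levels 0, ..., F, and the symmetric conditions
    determine the terms of negative level from them. *)
Lemma product_conditions_geometric (sigma : int -> R) : (0 < F)%N ->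
    (forall l, l \in levels F -> 0 < sigma l) ->
    (forall l : int, 1 <= l <= F%:Z - 1 ->
       sigma (l - 1) * sigma (l + 1) = sigma l ^+ 2) ->
    (forall l : int, 1 <= l <= F%:Z -> sigma l * sigma (- l) = sigma 0 ^+ 2) ->
  {in levels F, forall l, sigma l = sigma 0 * (sigma 1 / sigma 0) ^ l}.
Proof.
move=> F_gt0 sg_gt0 mid sym; set q := sigma 1 / sigma 0.
have s0 : sigma 0 != 0 by rewrite lt0r_neq0 // sg_gt0 // mem_levels; lia.
have s1 : sigma 1 != 0 by rewrite lt0r_neq0 // sg_gt0 // mem_levels; lia.
have q0 : q != 0 by rewrite mulf_neq0 ?invr_neq0.
have up k : (k < F)%N ->
    sigma k%:Z = sigma 0 * q ^+ k /\ sigma k.+1%:Z = sigma 0 * q ^+ k.+1.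
  elim: k => [_|k IH kF].
    by rewrite expr0 mulr1 expr1 mulrCA divff ?mulr1.
  have [IH0 IH1] := IH (ltnW kF).
  have k2 : sigma k%:Z * sigma k.+2%:Z = sigma k.+1%:Z ^+ 2.
    have -> : k%:Z = k.+1%:Z - 1 by lia.
    have -> : k.+2%:Z = k.+1%:Z + 1 by lia.
    by apply: mid; lia.
  split; first exact: IH1.
  apply: (mulfI (mulf_neq0 s0 (expf_neq0 k q0))).
  rewrite -IH0 k2 IH0 IH1 !exprS.
  by ring.
have pos k : (k <= F)%N -> sigma k%:Z = sigma 0 * q ^+ k.
  case: k => [_|k kF]; first by rewrite expr0 mulr1.
  by have [] := up k kF.
case=> k; rewrite mem_levels => lF; first by apply: pos; lia.
have kF : (k.+1 <= F)%N by lia.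
have e : sigma k.+1%:Z * sigma (Negz k) = sigma 0 ^+ 2.
  by rewrite NegzE; apply: sym; lia.
apply: (mulfI (mulf_neq0 s0 (expf_neq0 k.+1 q0))).
by rewrite -pos // e pos // NegzE -exprnN mulrACA mulfV ?expf_neq0 //
  mulr1 expr2.
Qed.

Definition partition_sum (t : R) : R := \sum_(l <- levels F) a l * t ^ l.

(** With sigma_l = c q^l, the normalization gives c^2 = 1 / S(q^2), and
    subtracting M times it from the second constraint leaves
    c^2 H(q^2) = 0. *)
Lemma psi_coeffs_sqrt (sigma : int -> R) :
    (0 < F)%N -> psi_coeffs M w sigma ->
  exists r, [/\ 0 < r, centered_moment (levels F) a M r = 0
    & {in levels F, forall l, sigma l = Num.sqrt (r ^ l / partition_sum r)}].
Proof.
move=> F_gt0 [sg_gt0 sum1 sumM mid sym].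
have sgE := product_conditions_geometric F_gt0 sg_gt0 mid sym.
set c := sigma 0 in sgE; set q := sigma 1 / c in sgE.
have c_gt0 : 0 < c by rewrite sg_gt0 // mem_levels; lia.
have q_gt0 : 0 < q by rewrite divr_gt0 // sg_gt0 // mem_levels; lia.
(* Otherwise expfzMl below would see the quotient behind q. *)
clearbody q.
have sg2 l : l \in levels F -> sigma l ^+ 2 = c ^+ 2 * (q ^+ 2) ^ l.
  by move=> /sgE ->; rewrite exprMn [q ^+ 2]expr2 expfzMl -[q ^ l * _]expr2.
have cS : c ^+ 2 * partition_sum (q ^+ 2) = 1.
  rewrite -sum1 mulr_sumr !big_seq; apply: eq_bigr => l lF.
  by rewrite sg2 // mulrCA.
exists (q ^+ 2); split; first exact: exprn_gt0.
  apply: (mulfI (expf_neq0 2 (lt0r_neq0 c_gt0))); rewrite mulr0.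
  transitivity (M - M * 1); last by rewrite mulr1 subrr.
  rewrite -[in RHS]sum1 -[X in X - _ * _]sumM !mulr_sumr -sumrB !big_seq.
  by apply: eq_bigr => l lF; rewrite sg2 // /a; ring.
move=> l lF; rewrite -[LHS]gtr0_norm ?sg_gt0 // -sqrtr_sqr; congr Num.sqrt.
have S0 : partition_sum (q ^+ 2) != 0.
  by apply/eqP => S0; move: cS; rewrite S0 mulr0 => /eqP;
    rewrite eq_sym oner_eq0.
by apply: (mulIf S0); rewrite divfK // sg2 // mulrAC cS mul1r.
Qed.

(** The squares of the coefficients are r^l / S, so H(r) = 0 turns the second
    constraint into M S / S = M; a product of two coefficients depends only on
    the sum of their levels, whence the product conditions. *)
Lemma psi_coeffs_of_zero r :
    0 < r -> 0 < partition_sum r -> centered_moment (levels F) a M r = 0 ->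
  psi_coeffs M w (fun l => Num.sqrt (r ^ l / partition_sum r)).
Proof.
move=> r_gt0 S_gt0 r0; have S0 := lt0r_neq0 S_gt0.
have r_neq0 := lt0r_neq0 r_gt0.
set S := partition_sum r in S_gt0 S0 *.
have x_ge0 l : 0 <= r ^ l / S by rewrite divr_ge0 ?exprz_ge0 ?ltW.
have sqE l : Num.sqrt (r ^ l / S) ^+ 2 = r ^ l / S by rewrite sqr_sqrtr.
have mulE l k : Num.sqrt (r ^ l / S) * Num.sqrt (r ^ k / S)
    = Num.sqrt (r ^ (l + k) / S ^+ 2).
  by rewrite -sqrtrM // expfzDr // mulf_div -expr2.
split.
- by move=> l _; rewrite sqrtr_gt0 divr_gt0 ?exprz_gt0.
- under eq_bigr => l _ do rewrite sqE mulrA.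
  by rewrite -mulr_suml divff.
- under eq_bigr => l _ do rewrite sqE mulrA.
  rewrite -mulr_suml; apply: (mulIf S0); rewrite divfK //.
  apply: subr0_eq; rewrite -[RHS]r0 /S /partition_sum mulr_sumr -sumrB.
  by apply: eq_bigr => l _; rewrite /a; ring.
- move=> l _; rewrite [RHS]expr2 !mulE; congr (Num.sqrt (r ^ _ / _)); lia.
- move=> l _; rewrite [RHS]expr2 !mulE; congr (Num.sqrt (r ^ _ / _)); lia.
Qed.

Lemma partition_sum_gt0 r :
    0 < \sum_(l <- levels F | M < l%:~R) a l -> 0 < r -> 0 < partition_sum r.
Proof.
move=> up_gt0 r_gt0.
have a_ge0 l : 0 <= a l by exact: sqr_ge0.
rewrite /partition_sum; under eq_bigr => l _ do rewrite mulrC.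
rewrite (bigID (fun l : int => M < l%:~R)) /=; apply: ltr_pwDl.
  by apply: weighted_sum_gt0 => // l _; exact: exprz_gt0.
by apply: sumr_ge0 => l _; rewrite mulr_ge0 // exprz_ge0 // ltW.
Qed.

End PsiCoefficients.

Theorem lemma6p3 (R : realType) (F n : nat) (M : R)
    (hF : (1 <= F)%N) (hn : (0 < n)%N) (hn_even : ~~ odd n)
    (hM0 : 0 <= M) (hMF : M < F%:R) (hMZ : M \isn't a Num.int)
    (w : 'cV[R]_(dimN F n)) (hw : Omega M w) :
  exists r : R,
    unique (fun t : R => 0 < t /\ root (h2 M w) t) r /\
    forall v : 'cV[R]_(dimN F n),
      is_psi M w v <->
      v = blockvec F (fun l : int =>
            Num.sqrt (r ^ l /
              \sum_(k <- levels F) norm2 (block w k) ^+ 2 * r ^ k)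
            *: block w l).
Proof.
have [lower_gt0 upper_gt0] := hw.
have a_ge0 l : 0 <= norm2 (block w l) ^+ 2 by exact: sqr_ge0.
have /andP[leM ltM1] := floor_itv M.
have ltM : (Num.floor M)%:~R < M by rewrite lt_neqAle leM andbT -intrEfloor.
have [x [y [x_gt0 le_xy x_le0 y_ge0]]] :=
  centered_moment_sign_change a_ge0 ltM ltM1 upper_gt0 lower_gt0.
have y_gt0 := lt_le_trans x_gt0 le_xy.
have [|r /andP[le_xr _] rootr] := @poly_ivt _ (h2 M w) x y le_xy.
  rewrite !horner_h2 // pmulr_rle0 ?exprz_gt0 // pmulr_rge0 ?exprz_gt0 //.
  by rewrite x_le0.
have r_gt0 := lt_le_trans x_gt0 le_xr.
have r0 : centered_moment (levels F) (fun l => norm2 (block w l) ^+ 2) M r = 0.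
  by apply/eqP; rewrite -root_h2.
have r_uniq := centered_moment_zero_inj a_ge0 ltM ltM1 upper_gt0 r_gt0 _ r0.
exists r; split.
  by split=> // t [t_gt0]; rewrite root_h2 // => /eqP; exact: r_uniq.
move=> v; split=> [[sigma [sg ->]] | ->].
  have [t [t_gt0 /(r_uniq _ t_gt0) <- sgE]] := psi_coeffs_sqrt hF sg.
  by apply: eq_blockvec => l /sgE ->.
exists (fun l => Num.sqrt (r ^ l / partition_sum w r)); split=> //.
exact: psi_coeffs_of_zero r_gt0 (partition_sum_gt0 upper_gt0 r_gt0) r0.
Qed.
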